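(* Let $G$ be a countable amenable group, let $A\subseteq G$ have $d^*_l(A)>0$ and let $F=(F_N)_{N\in\mathbb{N}}$ be a sequence of finite, nonempty subsets of $G$. Then there exist $k\in\mathbb{N}$ (here $k\ge 1$) and $B\subseteq G$ such that $\overline{d}_F(B)>0$ and $B^kB^k:=\{x^ky^k:x,y\in B\}\subseteq AA^{-1}$. Moreover, one can take $k\leq\frac{1}{d^*_l(A)^2}+1$.
   Context: ''Countable'' means in bijective correspondence with $\mathbb{N}$. A left Følner sequence in a countable group $G$ is a sequence $(F_N)_{N\in\mathbb{N}}$ of finite nonempty subsets of $G$ such that $\lim_{N\to\infty}\frac{|gF_N\Delta F_N|}{|F_N|}=0$ for all $g\in G$; $G$ is amenable if it has a left Følner sequence. For any sequence $F=(F_N)$ of finite nonempty subsets of $G$ and $E\subseteq G$, $\overline{d}_F(E)=\limsup_{N\to\infty}\frac{|E\cap F_N|}{|F_N|}$. The left upper Banach density is $d^*_l(E)=\sup\{\overline{d}_F(E):F\text{ a left Følner sequence in }G\}$. $AA^{-1}=\{aa'^{-1}:a,a'\in A\}$. *)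

(* Defs.v *)
From mathcomp Require Import all_boot all_order all_algebra finmap.
From mathcomp Require Import all_classical all_reals all_analysis.
Import numFieldNormedType.Exports.

Set Implicit Arguments.
Unset Strict Implicit.
Unset Printing Implicit Defensive.

Import Order.TTheory GRing.Theory Num.Theory.

Local Open Scope classical_set_scope.
Local Open Scope ring_scope.

Definition translate (G : groupType) (g : G) (S : {fset G}) : {fset G} :=
  [fset (g * x)%g | x in S]%fset.

Definition symdiff (G : groupType) (S T : {fset G}) : {fset G} :=
  ((S `\` T) `|` (T `\` S))%fset.

Definition left_Folner (R : realType) (G : groupType) (F : nat -> {fset G})
    : Prop :=
  (forall N, F N != fset0) /\
  (forall g : G,
     (#|` symdiff (translate g (F N)) (F N)|%:R / #|` F N|%:R : R)
       @[N --> \oo] --> (0 : R)).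

Definition amenable (R : realType) (G : groupType) : Prop :=
  exists F : nat -> {fset G}, left_Folner R F.

Definition upper_density (R : realType) (G : groupType) (F : nat -> {fset G})
    (E : set G) : R :=
  limn_sup (fun N => #|` [fset x in F N | x \in E]%fset|%:R / #|` F N|%:R : R).

(* The densities lie in [0, 1], so this real-valued [sup] is the usual supremum
   as soon as a left Folner sequence exists, i.e. when [G] is amenable. *)
Definition left_upper_Banach_density (R : realType) (G : groupType)
    (E : set G) : R :=
  sup [set upper_density R F E | F in [set F | left_Folner R F]].

Definition quotient_set (G : groupType) (A : set G) : set G :=
  [set (a * b^-1)%g | a in A & b in A].

Definition power_product_set (G : groupType) (k : nat) (B : set G) : set G :=
  [set (x ^+ k * y ^+ k)%g | x in B & y in B].

(* Main.v *)
Require Import Defs.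
From mathcomp Require Import all_boot all_order all_algebra finmap.
From mathcomp Require Import all_classical all_reals all_analysis.
From mathcomp Require Import ring lra zify.
Import Order.TTheory GRing.Theory Num.Theory.
Import numFieldNormedType.Exports.
Local Open Scope classical_set_scope.
Local Open Scope card_scope.
Local Open Scope ring_scope.

(** For a point [t] of [G] let [Q_k(t)] be the set of those [x] with [x^k t] and
[x^-k t] both in [A].  If [x] and [y] lie in the same [Q_k(t)], then
[x^k y^k = (x^k t) (y^-k t)^-1] lies in [A A^-1].  So any [B] such that each
pair of its elements lies in a common [Q_k(t)] will do, and the point [t] may
depend on the pair.

Write [d] for the left upper Banach density of [A] and [K] for the integer part
of [1/d].  Averaging along a Folner sequence and taking a limit along an
ultrafilter gives a left invariant, finitely additive mean [M] on [G] with
[(K+1) M(A) > 1] ([dense_mean]).  For each [x] the [K+1] sets [x^(2j) A],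
[0 <= j <= K], then cannot be disjoint in mean; by invariance the overlap of
[x^(2i) A] and [x^(2j) A] has the mean of the set of [t] with [x] in
[Q_(j-i)(t)].  Hence the sum over [1 <= k <= K] of the means of
[{t | x in Q_k(t)}] is bounded below by a constant [c > 0] which does not depend
on [x] ([power_recurrence]).  Averaging over [x] in [F_N] and using the
pigeonhole principle on [k], one finds a single [k <= K <= 1/d <= 1/d^2 + 1] such
that for infinitely many [N] the function [t |-> |F_N :&: Q_k(t)| / |F_N|] has
mean at least [c/K].

If [M] were a countably additive measure, Fatou's lemma would now give a point
[t] such that [Q_k(t)] has positive upper density along [F], and [B = Q_k(t)]
would do.  Means do not satisfy Fatou's lemma, but [mean_fatou] gives what is
needed: consecutive blocks of indices, and for each [n] a point [t_n] for which
each of the first [n+1] blocks contains an index [N] where the function is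
larger than [c/(2K)].  The set [B] is the limit of the sets [Q_k(t_n)] along an
ultrafilter.  A finite number of membership questions about [B] has the same
answers for some [Q_k(t_n)], so that both the lower bounds on densities and the
existence of a common [t] for two elements pass to [B]
([density_limit_set]). *)

(** * Means on bounded functions *)

Definition bounded_function (R : realType) (T : Type) (f : T -> R) : Prop :=
  exists C, forall t, `|f t| <= C.

(** Finitely additive means, presented as positive normalized linear functionals.
The functional is total, and its values on unbounded functions are arbitrary. *)
Record is_mean (R : realType) (T : Type) (M : (T -> R) -> R) : Prop := IsMean {
  mean_cst : forall a, M (fun=> a) = a;
  meanD : forall f g, bounded_function R T f -> bounded_function R T g ->
    M (fun t => f t + g t) = M f + M g;
  meanZ : forall a f, bounded_function R T f -> M (fun t => a * f t) = a * M f;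
  mean_le : forall f g, bounded_function R T f -> bounded_function R T g ->
    (forall t, f t <= g t) -> M f <= M g }.

Arguments bounded_function {R T} f.
Arguments is_mean {R T} M.
Arguments mean_cst {R T M} _ a.
Arguments meanD {R T M} _ f g.
Arguments meanZ {R T M} _ a f.
Arguments mean_le {R T M} _ f g.

Section Mean.
Context {R : realType} {T : Type}.
Implicit Types (f g : T -> R) (a : R).

Lemma bounded_function01 f : (forall t, 0 <= f t <= 1) -> bounded_function f.
Proof.
by move=> f01; exists 1 => t; case/andP: (f01 t) => f0 f1; rewrite ger0_norm.
Qed.

Lemma bounded_function_cst a : bounded_function (fun _ : T => a).
Proof. by exists `|a|. Qed.

Lemma bounded_functionD f g : bounded_function f -> bounded_function g ->
  bounded_function (fun t => f t + g t).
Proof.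
move=> [C fC] [D gD]; exists (C + D) => t.
by rewrite (le_trans (ler_normD _ _))// lerD.
Qed.

Lemma bounded_functionZ a f :
  bounded_function f -> bounded_function (fun t => a * f t).
Proof.
by move=> [C fC]; exists (`|a| * C) => t; rewrite normrM ler_wpM2l.
Qed.

Lemma bounded_functionB f g : bounded_function f -> bounded_function g ->
  bounded_function (fun t => f t - g t).
Proof.
move=> bf [C gC]; apply: bounded_functionD => //; exists C => t; by rewrite normrN.
Qed.

Lemma bounded_function_sum (I : Type) (s : seq I) (F : I -> T -> R) :
  (forall i, bounded_function (F i)) ->
  bounded_function (fun t => \sum_(i <- s) F i t).
Proof.
move=> bF; elim: s => [|i s IH].
  by exists 0 => t; rewrite big_nil normr0.
have [C hC] := bounded_functionD _ _ (bF i) IH.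
by exists C => t; rewrite big_cons.
Qed.

Context {M : (T -> R) -> R} (mM : is_mean M).

Lemma meanB f g : bounded_function f -> bounded_function g ->
  M (fun t => f t - g t) = M f - M g.
Proof.
move=> bf bg; rewrite -[in RHS]mulN1r -(meanZ mM)// -(meanD mM)//;
  last exact: bounded_functionZ.
by congr M; apply: funext => t; rewrite mulN1r.
Qed.

Lemma mean_sum (I : Type) (s : seq I) (F : I -> T -> R) :
  (forall i, bounded_function (F i)) ->
  M (fun t => \sum_(i <- s) F i t) = \sum_(i <- s) M (F i).
Proof.
move=> bF; elim: s => [|i s IH].
  rewrite big_nil -[RHS](mean_cst mM).
  by congr M; apply: funext => t; rewrite big_nil.
rewrite big_cons -IH -(meanD mM)//; last exact: bounded_function_sum.
by congr M; apply: funext => t; rewrite big_cons.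
Qed.

Lemma mean_gt a f : bounded_function f -> a < M f -> exists t, a < f t.
Proof.
move=> bf aM; apply: contrapT => /forallNP na.
suff : M f <= a by rewrite leNgt aM.
rewrite -[leRHS](mean_cst mM); apply: (mean_le mM) => //.
  exact: bounded_function_cst.
by move=> t; rewrite leNgt; apply/negP.
Qed.

End Mean.

(** * A substitute for Fatou's lemma *)

Section Fatou.
Context {R : realType} {T : Type}.

Definition block_max (f : nat -> T -> R) (m n : nat) (t : T) : R :=
  \big[Num.max/0]_(m <= N < n) f N t.

Variable f : nat -> T -> R.
Hypothesis f01 : forall N t, 0 <= f N t <= 1.

Lemma block_max01 m n t : 0 <= block_max f m n t <= 1.
Proof.
rewrite /block_max; elim/big_ind: _ => //; first by rewrite lexx ler01.
move=> a b /andP[a0 a1] /andP[b0 b1].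
by rewrite le_max a0 ge_max a1 b1.
Qed.

Lemma le_block_max m n N t : (m <= N < n)%N -> f N t <= block_max f m n t.
Proof.
move=> h; rewrite /block_max (bigD1_seq N) ?iota_uniq ?mem_index_iota//=.
by rewrite le_max lexx.
Qed.

Lemma block_max_le m n a t : 0 <= a ->
  (forall N, (m <= N < n)%N -> f N t <= a) -> block_max f m n t <= a.
Proof.
move=> a0 h; rewrite /block_max big_nat_cond.
elim/big_ind: _ => //.
- by move=> u v ua va; rewrite ge_max ua va.
- by move=> N; rewrite andbT; exact: h.
Qed.

Lemma lt_block_max m n a t : 0 <= a -> a < block_max f m n t ->
  exists2 N, (m <= N < n)%N & a < f N t.
Proof.
move=> a0 ab; apply: contrapT => nex.
move: ab; rewrite ltNge => /negP; apply.
apply: block_max_le => // N mNn; rewrite leNgt; apply/negP => aN.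
by apply: nex; exists N.
Qed.

Lemma block_max_sub m n m' n' t : (m <= m')%N -> (n' <= n)%N ->
  block_max f m' n' t <= block_max f m n t.
Proof.
move=> mm nn; apply: block_max_le => [|N /andP[h1 h2]].
  by case/andP: (block_max01 m n t).
by apply: le_block_max; rewrite (leq_trans mm h1) (leq_trans h2 nn).
Qed.

(** The mean of the maximum of [f] over the indices from [m] to [n] increases with
[n] and is at most 1, so a long enough block comes within [e i] of the supremum.
The blocks are chosen one after the other in this way. *)
Lemma mean_block_sequence (M : (T -> R) -> R) (e : nat -> R) :
  is_mean M -> (forall i, 0 < e i) ->
  exists2 v : nat -> nat, (forall i, (v i < v i.+1)%N) &
    forall i n, (v i.+1 <= n)%N ->
      M (block_max f (v i) n) <= M (block_max f (v i) (v i.+1)) + e i.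
Proof.
move=> mM e_gt0.
have bb m n : bounded_function (block_max f m n).
  by apply: bounded_function01; exact: block_max01.
have step m i : exists l, forall n, (m < n)%N ->
    M (block_max f m n) <= M (block_max f m (m + l.+1)) + e i.
  pose E := [set M (block_max f m (m + l.+1)) | l in [set: nat]].
  have hE : has_sup E.
    split; first by exists (M (block_max f m (m + 1))); exists 0%N.
    exists 1 => _ [l _ <-]; rewrite -[leRHS](mean_cst mM).
    apply: (mean_le mM) => //; first exact: bounded_function_cst.
    by move=> t; case/andP: (block_max01 m (m + l.+1) t).
  have [_ [l _ <-] hl] := sup_adherent (e_gt0 i) hE.
  exists l => n mn; rewrite -lerBlDr (le_trans _ (ltW hl))// lerD2r.
  apply: (sup_upper_bound hE); exists (n - m.+1)%N => //.
  by rewrite -subSn// subSS subnKC// ltnW.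
pose l m i := projT1 (cid (step m i)).
pose v := fix v i := if i is j.+1 then (v j + (l (v j) j).+1)%N else 0%N.
have vS i : (v i < v i.+1)%N by rewrite /= addnS ltnS leq_addr.
exists v => // i n vn.
exact: (projT2 (cid (step (v i) i)) n (leq_trans (vS i) vn)).
Qed.

Lemma sum_dyadic (c : R) k :
  \sum_(i <- index_iota 0 k) c / 2 ^+ i.+2 = c / 2 - c / 2 ^+ k.+1.
Proof.
elim: k => [|k IH]; first by rewrite big_nil expr1 subrr.
rewrite big_nat_recr//= IH !exprS; field.
by rewrite expf_neq0// pnatr_eq0.
Qed.

(** Let [g i] be the maximum of [f] over the [i]-th block.  For [i < k] the
maximum of [g i] and [g k] is a maximum over indices from [v i] on, so by the
choice of the blocks its mean exceeds that of [g i] by at most [c / 2^(i+2)].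
Thus the positive parts of the [g k - g i] have means adding up to less than
[c / 2], and after subtracting all of them from [g k] a mean larger than [c / 2]
is left.  At a point where the difference exceeds [c / 2] so does each
[g i]. *)
Lemma mean_fatou (M : (T -> R) -> R) (c : R) :
  is_mean M -> 0 < c -> (forall N, c <= M (f N)) ->
  exists2 v : nat -> nat, (forall i, (v i < v i.+1)%N) &
    forall k, exists t, forall i, (i <= k)%N ->
      exists2 N, (v i <= N < v i.+1)%N & c / 2 < f N t.
Proof.
move=> mM c_gt0 hc.
have e_gt0 i : 0 < c / 2 ^+ i.+2 by rewrite divr_gt0// exprn_gt0.
have [v vS hv] := mean_block_sequence M (fun i => c / 2 ^+ i.+2) mM e_gt0.
exists v => // k.
pose g i := block_max f (v i) (v i.+1).
have bg i : bounded_function (g i).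
  by apply: bounded_function01 => t; exact: block_max01.
have bf N : bounded_function (f N) by exact: bounded_function01.
(* [d i] is the positive part of [g k - g i]. *)
pose d i t := Num.max (g i t) (g k t) - g i t.
have g01 i t : 0 <= g i t <= 1 by exact: block_max01.
have bm i : bounded_function (fun t => Num.max (g i t) (g k t)).
  apply: bounded_function01 => t; case/andP: (g01 i t) => a0 a1.
  case/andP: (g01 k t) => b0 b1.
  by rewrite le_max a0 ge_max a1 b1.
have bd i : bounded_function (d i) by exact: bounded_functionB.
have vmono : {homo v : i j / (i <= j)%N}.
  by apply: homo_leq => // [|i]; [exact: leq_trans|exact: ltnW].
have Md i : (i < k)%N -> M (d i) <= c / 2 ^+ i.+2.
  move=> ik; rewrite (meanB mM)// lerBlDl.
  apply: (le_trans _ (hv i (v k.+1) (vmono _ _ (leqW ik)))).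
  apply: (mean_le mM) => //.
    by apply: bounded_function01 => t; exact: block_max01.
  move=> t; rewrite ge_max; apply/andP; split; apply: block_max_sub => //.
  - exact/vmono/leqW.
  - exact/vmono/ltnW.
pose h t := g k t - \sum_(i <- index_iota 0 k) d i t.
have bh : bounded_function h.
  by apply: bounded_functionB => //; exact: bounded_function_sum.
have Mh : c / 2 < M h.
  rewrite (meanB mM)//; last exact: bounded_function_sum.
  rewrite (mean_sum mM)//.
  have h1 : \sum_(i <- index_iota 0 k) M (d i) <= c / 2 - c / 2 ^+ k.+1.
    rewrite -sum_dyadic big_nat_cond [leRHS]big_nat_cond; apply: ler_sum => i.
    by rewrite andbT => /andP[_ /Md].
  have h2 : c <= M (g k).
    apply: (le_trans (hc (v k))); apply: (mean_le mM) => // t.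
    by apply: le_block_max; rewrite leqnn vS.
  have h3 : 0 < c / 2 ^+ k.+1 by rewrite divr_gt0// exprn_gt0.
  lra.
have [t ht] := mean_gt mM _ _ bh Mh.
exists t => i ik; apply: lt_block_max; first by rewrite divr_ge0// ltW.
have d0 j : 0 <= d j t by rewrite subr_ge0 le_max lexx.
rewrite -/(g i t) (lt_le_trans ht)//.
move: ik; rewrite leq_eqVlt => /orP[/eqP->|ik].
  by rewrite /h lerBlDr lerDl sumr_ge0.
apply: (@le_trans _ _ (g k t - d i t)).
  rewrite /h lerD2l lerN2 (bigD1_seq i) ?iota_uniq ?mem_index_iota//=.
  by rewrite lerDl sumr_ge0.
rewrite /d lerBlDr -lerBlDl.
have : g k t <= Num.max (g i t) (g k t) by rewrite le_max lexx orbT.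
lra.
Qed.

End Fatou.

(** * Averages over finite sets *)

Definition average {R : realType} {T : choiceType} (S : {fset T})
    (f : T -> R) : R :=
  (\sum_(t <- S) f t) / #|` S|%:R.

Definition density {R : realType} {T : choiceType} (S : {fset T})
    (E : set T) : R :=
  #|` [fset x in S | x \in E]%fset|%:R / #|` S|%:R.

Section Average.
Context {R : realType} {T : choiceType}.
Implicit Types (S : {fset T}) (f g : T -> R) (E : set T).

Lemma densityE S E : density S E = average S (fun t => (t \in E)%:R) :> R.
Proof.
rewrite /density /average; congr (_ / _).
rewrite card_fset_sum1 big_fset /= natr_sum big_mkcond /=.
by apply: eq_bigr => t _; case: (t \in E).
Qed.

Lemma density01 S E : 0 <= (density S E : R) <= 1.
Proof.
rewrite /density divr_ge0//=.
have [->|S0] := eqVneq #|` S| 0%N; first by rewrite invr0 mulr0 ler01.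
rewrite ler_pdivrMr ?ltr0n ?lt0n// mul1r ler_nat.
by apply: fsubset_leq_card; apply: fset_sub.
Qed.

Lemma averageD S f g : average S (fun t => f t + g t) = average S f + average S g.
Proof. by rewrite /average big_split /= mulrDl. Qed.

Lemma averageZ S (a : R) f : average S (fun t => a * f t) = a * average S f.
Proof. by rewrite /average -mulr_sumr mulrA. Qed.

Lemma le_average S f g : (forall t, f t <= g t) -> average S f <= average S g.
Proof. by move=> fg; rewrite /average ler_wpM2r ?invr_ge0// ler_sum. Qed.

Lemma average_cst S (a : R) : S != fset0 -> average S (fun=> a) = a.
Proof.
move=> S0; rewrite /average big_const_seq count_predT iter_addr_0 -(mulr_natr a) mulfK//.
by rewrite pnatr_eq0 cardfs_eq0.
Qed.

Lemma norm_average_le S f C : S != fset0 -> (forall t, `|f t| <= C) ->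
  `|average S f| <= C.
Proof.
move=> S0 fC; rewrite ler_norml; apply/andP; split.
  by rewrite -(average_cst S (- C))//; apply: le_average => t;
    move: (fC t); rewrite ler_norml => /andP[].
by rewrite -[leRHS](average_cst S C)//; apply: le_average => t;
    move: (fC t); rewrite ler_norml => /andP[].
Qed.

End Average.

(** * Upper limits of sequences in the unit interval *)

Section LimSup.
Context {R : realType}.
Variable u : nat -> R.
Hypothesis u01 : forall n, 0 <= u n <= 1.

Lemma bounded_01 : bounded_fun (u : nat -> R^o).
Proof.
exists 1; split; first exact: real1.
move=> x x1 n _ /=; case/andP: (u01 n) => u0 u1.
by rewrite ger0_norm// (le_trans u1)// ltW.
Qed.

Lemma has_sup_tail n : has_sup [set u k | k in [set k | (n <= k)%N]].
Proof.
split; first by exists (u n); exists n => /=.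
by exists 1 => _ [k _ <-]; case/andP: (u01 k).
Qed.

Lemma has_inf_sups : has_inf (range (sups (R:=R) u)).
Proof.
split; first by exists (sups u 0%N); exists 0%N.
exists 0 => _ [n _ <-]; case/andP: (u01 n) => u0 _; apply: (le_trans u0).
by apply: (sup_upper_bound (has_sup_tail n)); exists n => /=.
Qed.

Lemma lt_limn_sup a : a < limn_sup u -> forall n, exists2 k, (n <= k)%N & a < u k.
Proof.
rewrite limn_supE; last exact: bounded_01.
move=> au n; have : a < sups u n.
  by apply: (lt_le_trans au); apply: (ge_inf (proj2 has_inf_sups)); exists n.
move=> asup; have := asup; rewrite -subr_gt0 => /sup_adherent /(_ (has_sup_tail n)).
move=> [_ [k /= nk <-]]; rewrite opprB addrC subrK => h.
by exists k.
Qed.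

Lemma le_limn_sup a : (forall n, exists2 k, (n <= k)%N & a <= u k) ->
  a <= limn_sup u.
Proof.
move=> h; rewrite limn_supE; last exact: bounded_01.
apply: lb_le_inf; first exact: (proj1 has_inf_sups).
move=> _ [n _ <-]; have [k nk auk] := h n; apply: (le_trans auk).
by apply: (sup_upper_bound (has_sup_tail n)); exists k.
Qed.

End LimSup.

(** * Limits along an ultrafilter *)

Section Ultra.
Variables (R : realType) (I : Type) (U : set_system I).
Context {UU : UltraFilter U}.

Lemma ultra_filter_proper : ProperFilter U. Proof. exact: ultra_proper. Qed.

(** A cluster point in [[-C, C]] exists by compactness, and an ultrafilter converges
to each of its cluster points because it contains each set or its complement. *)
Lemma ultra_bounded_cvg (u : I -> R) (C : R) :
  (forall i, `|u i| <= C) -> cvg (u i @[i --> U]).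
Proof.
move=> uC; have PF := ultra_filter_proper.
have UC : (u @ U) `[- C, C]%classic.
  by apply: (@filterE _ U) => i; rewrite /= in_itv /= -ler_norml.
have PuU : ProperFilter (u @ U) by exact: fmap_proper_filter.
have [l [_ cl]] := segment_compact PuU UC.
apply/cvg_ex; exists l => V Vl.
have [//|UnV] := in_ultra_setVsetC (u @^-1` V) UU.
by have [x [nVx Vx]] := cl (~` V) V UnV Vl.
Qed.

Lemma filter_all_seq (X : eqType) (s : seq X) (P : X -> set I) :
  (forall x, \forall i \near U, P x i) ->
  \forall i \near U, forall x, x \in s -> P x i.
Proof.
have PF := ultra_filter_proper.
move=> h; elim: s => [|x s IH]; first by apply: filterE.
apply: filterS (filterI (h x) IH) => i [Pxi IHi] y.
by rewrite inE => /predU1P[->|/IHi].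
Qed.

Definition ultra_limit_set (X : Type) (Q : I -> set X) : set X :=
  [set x | \forall i \near U, Q i x].

(** An ultrafilter decides whether [x] belongs to [Q i]: almost all of the [Q i]
contain [x], or almost all of them omit it. *)
Lemma ultra_limit_setP (X : Type) (Q : I -> set X) x :
  \forall i \near U, ultra_limit_set X Q x <-> Q i x.
Proof.
have PF := ultra_filter_proper.
have [UQ|UnQ] := in_ultra_setVsetC [set i | Q i x] UU.
  by apply: filterS (UQ) => i Qi; split.
apply: filterS (UnQ) => i nQi; split => // UQ.
by have [j [? ?]] := filter_ex (filterI UQ UnQ).
Qed.

End Ultra.

(** * Invariant means from Folner sequences *)

Section InvMean.
Variables (R : realType) (G : groupType).
Implicit Types (S T : {fset G}) (f : G -> R).

Lemma sum_fset_sub S T f : (S `<=` T)%fset ->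
  \sum_(x <- S) f x = \sum_(x <- T) (x \in S)%:R * f x.
Proof.
move=> ST.
have -> : S = [fset x in T | x \in S]%fset.
  apply/fsetP => x; rewrite !inE /=; case xS: (x \in S); last by rewrite andbF.
  by rewrite (fsubsetP ST).
rewrite big_fset /= big_mkcond /=; apply: eq_big_seq => x xT.
by rewrite !inE /= xT /=; case: (x \in S); rewrite ?mul1r ?mul0r.
Qed.

(** Both sums are taken over the union, where the difference of the two indicator
functions vanishes off the symmetric difference. *)
Lemma sum_symdiff_le S T f C : (forall t, `|f t| <= C) ->
  `|\sum_(x <- S) f x - \sum_(x <- T) f x| <= C * #|` symdiff S T|%:R.
Proof.
move=> fC.
rewrite (sum_fset_sub S (S `|` T)%fset) ?fsubsetUl//.
rewrite (sum_fset_sub T (S `|` T)%fset) ?fsubsetUr//.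
rewrite -sumrB (le_trans (ler_norm_sum _ _ _))//.
rewrite -[leRHS]mulr1 -mulrA mulr1 card_fset_sum1 natr_sum mulr_sumr.
rewrite (sum_fset_sub (symdiff S T) (S `|` T)%fset); last first.
  apply/fsubsetP => x; rewrite !inE.
  by case: (x \in S); case: (x \in T).
apply: ler_sum => x _; rewrite !inE.
by case: (x \in S); case: (x \in T);
  rewrite /= ?mul0r ?mul1r ?subrr ?subr0 ?sub0r ?normrN ?mulr1 ?normr0.
Qed.

Lemma average_translate_le S f C g : (forall t, `|f t| <= C) ->
  `|average S (fun t => f (g * t)%g) - average S f| <=
    C * (#|` symdiff (translate g S) S|%:R / #|` S|%:R).
Proof.
move=> fC; rewrite /average -mulrBl normrM mulrA.
rewrite [X in _ * X]ger0_norm ?invr_ge0// ler_wpM2r ?invr_ge0//.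
apply: le_trans (sum_symdiff_le _ _ _ _ fC).
rewrite /translate big_imfset//=.
by move=> x y _ _ /mulgI.
Qed.

Definition left_invariant (M : (G -> R) -> R) :=
  forall g f, bounded_function f -> M (fun t => f (g * t)%g) = M f.

(** The mean is an ultralimit of averages over the sets [F (h n)].  The
reindexing [h] serves to keep only the indices where a given set has density
close to its upper density. *)
Lemma exists_invariant_mean (F : nat -> {fset G}) (h : nat -> nat) :
  left_Folner R F -> (forall n, (n <= h n)%N) ->
  exists M : (G -> R) -> R, [/\ is_mean M, left_invariant M &
    forall a f, bounded_function f ->
      (forall n, a <= average (F (h n)) f) -> a <= M f].
Proof.
move=> [F0 FF] hn.
have [U [UU ooU]] := ultraFilterLemma eventually_filter.
have PU := ultra_filter_proper _ U.
have cvgM f : bounded_function f -> cvg (average (F (h n)) f @[n --> U]).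
  move=> [C fC]; apply: (@ultra_bounded_cvg R nat U UU _ C) => n.
  exact: norm_average_le.
have cvg_h (g : G) :
    (#|` symdiff (translate g (F (h N))) (F (h N))|%:R / #|` F (h N)|%:R : R)
    @[N --> U] --> (0 : R).
  move=> A /(FF g) [N _ NA]; apply: ooU; exists N => // n /= Nn.
  by apply: NA => /=; exact: leq_trans (hn n).
pose M f := lim (average (F (h n)) f @[n --> U]).
exists M; split.
- split => [a|f g bf bg|a f bf|f g bf bg fg].
  + rewrite /M; under eq_fun do rewrite average_cst//.
    exact: lim_cst.
  + rewrite /M; under eq_fun do rewrite averageD.
    by apply: cvg_lim => //; apply: cvgD; exact: cvgM.
  + rewrite /M; under eq_fun do rewrite averageZ.
    by apply: cvg_lim => //; apply: cvgMr; exact: cvgM.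
  + apply: ler_lim; [exact: cvgM|exact: cvgM|].
    by apply: filterE => n; exact: le_average.
- move=> g f bf; have [C fC] := bf.
  have bgf : bounded_function (fun t => f (g * t)%g) by exists C => t; exact: fC.
  apply/eqP; rewrite -subr_eq0; apply/eqP.
  have lim1 : (average (F (h n)) (fun t => f (g * t)%g) - average (F (h n)) f)
      @[n --> U] --> M (fun t => f (g * t)%g) - M f.
    by apply: cvgB; exact: cvgM.
  apply: (cvg_unique _ lim1) => //.
  apply/norm_cvg0P.
  apply: (@squeeze_cvgr _ U _ _ (fun=> 0)
    (fun n => C * (#|` symdiff (translate g (F (h n))) (F (h n))|%:R / #|` F (h n)|%:R : R))).
  + apply: filterE => n; rewrite normr_ge0 /=; exact: average_translate_le.
  + exact: cvg_cst.
  + rewrite -[X in _ --> X](mulr0 C); apply: cvgMr; exact: cvg_h.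
- move=> a f bf af; apply: limr_ge; first exact: cvgM.
  exact: filterE.
Qed.

(** * Recurrence along powers *)

(** With [a j] the indicator function of [x^(2j) A], for [0 <= j <= K], the
number of [j] with [a j t = 1] is at most one plus the number of pairs [i < j]
with [a i t * a j t = 1].  Translating by [x^(i+j)], the mean of [a i * a j] is
that of the summand with [k + 1 = j - i] on the right, and at most [K + 1] pairs
have the same difference.  The even exponents [2j] make this translation
possible. *)
Lemma power_recurrence (M : (G -> R) -> R) (A : set G) (x : G) (K : nat) :
  is_mean M -> left_invariant M ->
  K.+1%:R * M (fun t => (t \in A)%:R) - 1 <=
  K.+1%:R * \sum_(0 <= k < K)
    M (fun t => (((x ^+ k.+1 * t)%g \in A) && ((x ^- k.+1 * t)%g \in A))%:R).
Proof.
move=> mM iM.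
pose a (j : nat) t : R := ((x ^- (2 * j) * t)%g \in A)%:R.
pose q k := M (fun t => (((x ^+ k * t)%g \in A) && ((x ^- k * t)%g \in A))%:R).
have b01 (b : bool) : 0 <= (b%:R : R) <= 1 by case: b; rewrite ?lexx ?ler01.
have ba j : bounded_function (a j) by apply: bounded_function01 => t; exact: b01.
have a0 j t : 0 <= a j t by case/andP: (b01 ((x ^- (2 * j) * t)%g \in A)).
have baa i j : bounded_function (fun t => a i t * a j t).
  by apply: bounded_function01 => t; rewrite /a -natrM mulnb.
have Ma j : M (a j) = M (fun t => (t \in A)%:R).
  rewrite -(iM (x ^- (2 * j))%g (fun t => (t \in A)%:R))//.
  by apply: bounded_function01 => t; exact: b01.
have Maa i j : (i < j)%N -> M (fun t => a i t * a j t) = q (j - i)%N.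
  move=> ij; rewrite -(iM (x ^+ (i + j))%g (fun t => a i t * a j t))//.
  rewrite /q; congr M; apply: funext => t; rewrite /a -natrM mulnb.
  have -> : (x ^- (2 * i) * (x ^+ (i + j) * t) = x ^+ (j - i) * t)%g.
    have -> : (i + j = 2 * i + (j - i))%N by lia.
    by rewrite (expgnDr x (2 * i)) -mulgA mulKg.
  have -> : (x ^- (2 * j) * (x ^+ (i + j) * t) = x ^- (j - i) * t)%g.
    apply: (mulgI (x ^+ (2 * j))%g); rewrite mulVKg.
    have -> : (2 * j = (i + j) + (j - i))%N by lia.
    by rewrite (expgnDr x (i + j)) -mulgA mulVKg.
  by [].
have q_ge0 k : 0 <= q k.
  rewrite -[leLHS](mean_cst mM); apply: (mean_le mM).
  - exact: bounded_function_cst.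
  - by apply: bounded_function01 => t; exact: b01.
  - by move=> t; case/andP: (b01 (((x ^+ k * t)%g \in A) && ((x ^- k * t)%g \in A))).
(* A number [s] of sets containing [t] satisfies [s <= 1 + s (s - 1) / 2]. *)
have pw n t : \sum_(0 <= j < n) a j t <=
    1 + \sum_(0 <= j < n) \sum_(0 <= i < j) a i t * a j t.
  elim: n => [|n IH]; first by rewrite !big_nil addr0 ler01.
  rewrite !big_nat_recr//= -mulr_suml.
  have : 0 <= \sum_(0 <= j < n) \sum_(0 <= i < j) a i t * a j t.
    by apply: sumr_ge0 => j _; apply: sumr_ge0 => i _; exact: mulr_ge0.
  move: IH; set s := \sum_(0 <= j < n) a j t; set p := \sum_(0 <= j < n) _.
  clearbody s p => sp p0.
  have : a n t = 0 \/ a n t = 1.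
    by rewrite /a; case: (_ \in A); [right|left].
  by case=> ->; lra.
have bS n : bounded_function (fun t => \sum_(0 <= j < n) a j t).
  by apply: bounded_function_sum.
have bP n : bounded_function
    (fun t => \sum_(0 <= j < n) \sum_(0 <= i < j) a i t * a j t).
  by apply: bounded_function_sum => j; apply: bounded_function_sum.
have := mean_le mM _ _ (bS K.+1)
  (bounded_functionD _ _ (bounded_function_cst 1) (bP K.+1)) (pw K.+1).
rewrite (meanD mM)//; last exact: bounded_function_cst.
rewrite (mean_cst mM) !(mean_sum mM)//; last by move=> j; apply: bounded_function_sum.
rewrite (eq_bigr _ (fun j _ => Ma j)) sumr_const_nat subn0 lerBlDl !mulr_natl.
move=> /le_trans; apply; rewrite lerD2l.
rewrite -[X in _ <= _ *+ X](subn0 K.+1) -sumr_const_nat.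
rewrite big_nat_cond [leRHS]big_nat_cond; apply: ler_sum => j; rewrite andbT /= => jK.
rewrite (mean_sum mM)//.
have -> : \sum_(0 <= i < j) M (fun t => a i t * a j t) = \sum_(0 <= i < j) q i.+1.
  rewrite big_nat_rev /=; apply: eq_big_nat => i /andP[_ ij].
  rewrite add0n Maa; last by lia.
  by congr q; lia.
rewrite (@big_cat_nat _ _ _ j 0 K)//= lerDl.
by apply: sumr_ge0 => i _; exact: q_ge0.
Qed.

(** * Limits of random sets of positive density *)

(** When [t] is chosen at random with respect to [M], the set [Q t] has expected
density at least [c] on infinitely many of the [F N].  With [t k] the points
given by [mean_fatou], take for [B] the ultralimit of the sets [Q (t k)].  On the
finitely many [F N] of one block, [B] coincides with some [Q (t k)] such that
[k] is large, and this one is dense on one of them. *)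
Lemma density_limit_set (T : Type) (M : (T -> R) -> R) (F : nat -> {fset G})
    (Q : T -> set G) (c : R) :
  is_mean M -> 0 < c ->
  (forall n, exists2 N, (n <= N)%N & c <= M (fun t => density (F N) (Q t))) ->
  exists2 B : set G, 0 < upper_density R F B &
    forall x y, B x -> B y -> exists2 t, Q t x & Q t y.
Proof.
move=> mM c_gt0 freq.
(* [s] keeps indices with large expected density, without requiring that they
   increase: [n <= s n] is enough for an upper limit. *)
have /choice[s sP] n :
    exists N, (n <= N)%N /\ c <= M (fun t => density (F N) (Q t)).
  by have [N ? ?] := freq n; exists N.
have [v vS hv] := mean_fatou (fun n t => density (F (s n)) (Q t))
  (fun n t => density01 _ _) M c mM c_gt0 (fun n => (sP n).2).
have /choice[t tP] := hv.
have [U [UU ooU]] := ultraFilterLemma eventually_filter.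
have PU := ultra_filter_proper _ U.
pose B := ultra_limit_set nat U G (fun k => Q (t k)).
exists B; last first.
  by move=> x y Bx By; have [k [? ?]] := filter_ex (filterI Bx By); exists (t k).
apply: (@lt_le_trans _ _ (c / 2)); first by rewrite divr_gt0.
apply: le_limn_sup => [n|n]; first exact: density01.
have vn : (n <= v n)%N.
  by elim: (n) => // m IH; exact: leq_ltn_trans (vS m).
have near_n : \forall k \near U, (n <= k)%N.
  by apply: ooU; exists n.
have near_B : \forall k \near U, forall N, N \in iota 0 (v n.+1) ->
    forall x, x \in enum_fset (F (s N)) -> (B x <-> Q (t k) x).
  apply: filter_all_seq => N; apply: filter_all_seq => x.
  exact: ultra_limit_setP.
have [k [nk hk]] := filter_ex (filterI near_n near_B).
have [N /andP[vN Nv] hN] := tP k n nk.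
exists (s N); first by rewrite (leq_trans vn)// (leq_trans vN)//; exact: (sP N).1.
rewrite (le_trans (ltW hN))// -/(density (F (s N)) B) !densityE.
rewrite /average ler_wpM2r ?invr_ge0//.
rewrite le_eqVlt; apply/orP; left; apply/eqP.
apply: eq_big_seq => x xF; congr (_%:R).
have := hk N; rewrite mem_iota add0n Nv => /(_ isT x xF) [BQ QB].
by congr nat_of_bool; apply/idP/idP; rewrite !inE; [exact: QB|exact: BQ].
Qed.

Lemma infinite_pigeonhole (K : nat) (P : nat -> 'I_K -> Prop) :
  (forall N, exists k, P N k) ->
  exists k, forall n, exists2 N, (n <= N)%N & P N k.
Proof.
move=> h; apply: contrapT => /forallNP nex.
have /choice[b bP] k : exists n, forall N, (n <= N)%N -> ~ P N k.
  have /existsNP[n hn] := nex k; exists n => N nN PN.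
  by apply: hn; exists N.
have [k Pk] := h (\max_k b k).
by apply: (bP k _ _ Pk); exact: leq_bigmax.
Qed.

End InvMean.

(** * Common returns and products of powers *)

Definition two_sided_returns (G : groupType) (A : set G) (k : nat) (t : G) :
    set G :=
  [set x | A (x ^+ k * t)%g /\ A (x ^- k * t)%g].

(** The quotient of [x^k t] by [y^-k t] is [x^k y^k]. *)
Lemma power_product_in_quotient (G : groupType) (A : set G) k t x y :
  two_sided_returns G A k t x -> two_sided_returns G A k t y ->
  quotient_set A (x ^+ k * y ^+ k)%g.
Proof.
move=> [Ax _] [_ Ay]; exists (x ^+ k * t)%g => //; exists (y ^- k * t)%g => //.
by rewrite invgM invgK mulgA mulgK.
Qed.

Lemma mean_density (R : realType) (G : groupType) (M : (G -> R) -> R)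
    (S : {fset G}) (Q : G -> set G) :
  is_mean M ->
  M (fun t => density S (Q t)) = average S (fun x => M (fun t => (x \in Q t)%:R)).
Proof.
move=> mM; have b1 x : bounded_function (fun t => (x \in Q t)%:R : R).
  by exists 1 => t; case: (x \in Q t); rewrite ?normr0 ?normr1 ?ler01.
transitivity (M (fun t => (#|` S|%:R)^-1 * \sum_(x <- S) (x \in Q t)%:R)).
  by congr M; apply: funext => t; rewrite densityE mulrC.
rewrite (meanZ mM); last exact: bounded_function_sum.
by rewrite (mean_sum mM)// mulrC.
Qed.

Lemma dense_mean (R : realType) (G : groupType) (A : set G) (a : R) :
  0 <= a -> a < left_upper_Banach_density R A ->
  exists M : (G -> R) -> R,
    [/\ is_mean M, left_invariant R G M & a <= M (fun t => (t \in A)%:R)].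
Proof.
move=> a0 aA.
have hs : has_sup [set upper_density R F A | F in [set F | left_Folner R F]].
  apply: contrapT => /sup_out A0.
  by move: aA; rewrite /left_upper_Banach_density A0 ltNge a0.
have := aA; rewrite -subr_gt0 => /sup_adherent /(_ hs) [_ [F FF <-]].
rewrite opprB addrC subrK => aF.
have /choice[h hP] n : exists k, (n <= k)%N /\ a < density (F k) A.
  have [k nk ak] := lt_limn_sup _ (fun n => density01 (F n) A) a aF n.
  by exists k.
have [M [mM iM aM]] := exists_invariant_mean R G F h FF (fun n => (hP n).1).
exists M; split => //; apply: aM => [|n].
  by apply: bounded_function01 => t; case: (t \in A); rewrite ?lexx ?ler01.
by rewrite -densityE ltW//; exact: (hP n).2.
Qed.

Theorem theorem1p39 (R : realType) (G : groupType)
    (G_countable : [set: G] #= [set: nat])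
    (G_amenable : amenable R G)
    (A : set G) (A_density : 0 < left_upper_Banach_density R A)
    (F : nat -> {fset G}) (F_neq0 : forall N, F N != fset0) :
  exists k : nat, exists B : set G,
    [/\ (0 < k)%N,
        k%:R <= 1 / left_upper_Banach_density R A ^+ 2 + 1,
        0 < upper_density R F B
      & power_product_set k B `<=` quotient_set A].
Proof.
set d := left_upper_Banach_density R A in A_density *.
(* Any bound [K] with [K <= 1/d < K + 1] works: [(K + 1) a > 1] holds for some
   [a < d], and the exponent found below is at most [K]. *)
pose K := Num.truncn d^-1.
have dV_gt0 : 0 < d^-1 by rewrite invr_gt0.
have /andP[Kd dK] : K%:R <= d^-1 < K.+1%:R by apply: truncn_itv; exact: ltW.
have K1_gt0 : 0 < K.+1%:R :> R by rewrite ltr0n.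
pose a := (K.+1%:R^-1 + d) / 2.
have Kd1 : K.+1%:R^-1 < d by rewrite invf_plt// posrE.
have [Ka ad] := midf_lt Kd1; rewrite -/a in Ka ad.
have a_ge0 : 0 <= a by rewrite (le_trans _ (ltW Ka))// invr_ge0 ltW.
have [M [mM iM aM]] := dense_mean R G A a a_ge0 ad.
pose c := a - K.+1%:R^-1.
have c_gt0 : 0 < c by rewrite subr_gt0.
pose Q (k : 'I_K) := two_sided_returns G A k.+1.
have sumQ x : c <= \sum_(k < K) M (fun t => (x \in Q k t)%:R).
  have := power_recurrence R G M A x K mM iM.
  rewrite big_mkord => rec; rewrite -(ler_pM2l K1_gt0) /c mulrBr divff ?gt_eqF//.
  apply: (le_trans (lerB (ler_wpM2l (ltW K1_gt0) aM) (lexx 1))).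
  apply: (le_trans rec); rewrite le_eqVlt; apply/orP; left; apply/eqP.
  congr (_ * _).
  apply: eq_bigr => k _; congr M; apply: funext => t; congr (nat_of_bool _)%:R.
  by apply/andP/idP; rewrite !inE.
have pigeon N : exists k : 'I_K, c / K%:R <= M (fun t => density (F N) (Q k t)).
  apply: contrapT => /forallNP none.
  have : c <= \sum_(k < K) M (fun t => density (F N) (Q k t)).
    under eq_bigr do rewrite mean_density//.
    rewrite /average -mulr_suml exchange_big /= -/(average _ _).
    by rewrite -[leLHS](average_cst (F N))//; apply: le_average.
  (* For [K = 0] the empty sum would be at least [c]. *)
  have [K0|K_gt0] := posnP K.
    by rewrite big1 => [|k]; [rewrite leNgt c_gt0|have := ltn_ord k; rewrite {2}K0].
  rewrite leNgt => /negP; apply.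
  rewrite [ltRHS](_ : _ = \sum_(k < K) c / K%:R); last first.
    by rewrite sumr_const card_ord -(mulr_natr (c / _)) divfK// pnatr_eq0 -lt0n.
  apply: ltr_sum; first by apply/hasP; exists (Ordinal K_gt0);
    rewrite ?mem_index_enum.
  by move=> k _; rewrite ltNge; apply/negP; exact: none.
have [k hk] := infinite_pigeonhole _ _ pigeon.
have cK_gt0 : 0 < c / K%:R.
  by rewrite divr_gt0// ltr0n (leq_ltn_trans _ (ltn_ord k)).
have [B FB BQ] := density_limit_set R G G M F (Q k) _ mM cK_gt0 hk.
exists k.+1, B; split => //.
- apply: (@le_trans _ _ d^-1).
    by apply: le_trans Kd; rewrite ler_nat.
  (* [u <= u^2 + 1] with [u = 1/d] *)
  rewrite div1r -exprVn; move: (d^-1) => u; nra.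
- move=> _ [x Bx [y By <-]].
  have [t Qx Qy] := BQ x y Bx By.
  exact: (power_product_in_quotient _ _ _ t).
Qed.
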